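(* Let $X$ be a complex Banach space, $x\in X$ a unit vector, and $x^*\in X^*$ a functional that strongly exposes $x$. If $T=\{e^{tA}:t\ge 0\}$ is a $(C_0)$ contraction semigroup with generator $A$ such that \[\lim_{t\to\infty}|\langle T(t)x,x^*\rangle|=1,\] then $x$ is in the domain of $A$ and $Ax=i\lambda x$ for some real number $\lambda$.
   Context: Let $B$ denote the closed unit ball of $X$. For a unit vector $x^*\in X^*$ and $0<\alpha<1$, the slice is $S(B,x^*,\alpha)=\{y:\|y\|\le 1,\ \Re\langle y,x^*\rangle\ge 1-\alpha\}$. A functional $x^*\in X^*$ strongly exposes the unit vector $x$ if $\|x^*\|=1$, $\langle x,x^*\rangle = 1$, and $\lim_{\alpha\to0^+}\operatorname{diam} S(B,x^*,\alpha)=0$, where $\operatorname{diam} S=\sup\{\|y-z\|:y,z\in S\}$. *)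

(* Defs.v *)
From HB Require Import structures.
From mathcomp Require Import all_boot all_order all_algebra.
From mathcomp Require Import all_classical all_reals all_analysis.
From mathcomp Require Export complex.
Set Implicit Arguments. Unset Strict Implicit. Unset Printing Implicit Defensive.
Import Order.TTheory GRing.Theory Num.Theory.
Import numFieldTopology.Exports numFieldNormedType.Exports.
Local Open Scope classical_set_scope.
Local Open Scope ring_scope.
Local Open Scope complex_scope.

(* Topology (metric from the modulus) on the complex numbers R[i],
   copied from the generic one on the regular module R[i]^o. *)
HB.instance Definition _ (R : rcfType) := PseudoPointedMetric.copy R[i] (R[i])^o.

Section Defs.
Variables (R : realType) (X : completeNormedModType R[i]).

Definition dual_norm_one (f : X -> R[i]) : Prop :=
  (forall y : X, `|y| <= 1 -> `|f y| <= 1) /\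
  (forall e : R, 0 < e -> exists y : X, `|y| <= 1 /\ (1 - e)%:C < `|f y|).

Definition slice (f : X -> R[i]) (a : R) : set X :=
  [set y | `|y| <= 1 /\ 1 - a <= complex.Re (f y)].

Definition strongly_exposes (f : X -> R[i]) (x : X) : Prop :=
  dual_norm_one f /\ f x = 1 /\
  forall e : R, 0 < e -> exists d : R, 0 < d /\
    forall a : R, 0 < a -> a < d ->
      forall y z, slice f a y -> slice f a z -> `|y - z| <= e%:C.

(* (C_0) contraction semigroup T : [0,oo) -> L(X) (values at t<0 irrelevant). *)
Definition C0_contraction_semigroup (T : R -> {linear X -> X}) : Prop :=
  (forall y, T 0 y = y) /\
  (forall s t, 0 <= s -> 0 <= t -> forall y, T (s + t) y = T s (T t y)) /\
  (forall y, (fun t => T t y) @ 0^'+ --> y) /\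
  (forall t, 0 <= t -> forall y, `|T t y| <= `|y|).

(* x is in the domain of the generator A of T and A x = v. *)
Definition generator_at (T : R -> {linear X -> X}) (x v : X) : Prop :=
  (fun t : R => (t^-1)%:C *: (T t x - x)) @ 0^'+ --> v.

End Defs.

(* Main.v *)
(** For large [t] rotate [T(t)x] by a unimodular [c(t)] so that
    [xs (c(t) T(t)x) = |xs (T(t)x)|], which tends to 1; strong exposedness gives
    [c(t) T(t)x --> x]. Applying the contraction [T(s)] and comparing with
    [c(t+s) T(t+s)x --> x] shows that [T(s)x] is a limit of unimodular multiples
    of [x], so [T(s)x = f(s) x] where [f(s) = xs (T(s)x)] has modulus 1. Then [f]
    is a right-continuous semigroup in the unit circle; its argument is additive
    and bounded near 0, hence linear, and [f(t) = exp(i lam t)] for small [t]. *)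
Require Import Defs.
From HB Require Import structures.
From mathcomp Require Import all_boot all_order all_algebra.
From mathcomp Require Import all_classical all_reals all_analysis.
From mathcomp Require Import complex ring lra.
Import Order.TTheory GRing.Theory Num.Theory.
Import numFieldTopology.Exports numFieldNormedType.Exports.
Local Open Scope classical_set_scope.
Local Open Scope ring_scope.
Local Open Scope complex_scope.

(** * Order, norm and convergence in [R[i]] *)

Lemma gtC0_real (R : rcfType) (e : R[i]) : 0 < e -> exists2 r : R, 0 < r & e = r%:C.
Proof.
case: e => a b; rewrite ltcE /= => /andP[/eqP -> a0].
by exists a.
Qed.

Lemma geC0_real (R : rcfType) (e : R[i]) : 0 <= e -> exists2 r : R, 0 <= r & e = r%:C.
Proof.
case: e => a b; rewrite lecE /= => /andP[/eqP -> a0].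
by exists a.
Qed.

Lemma normr_real_complex (R : rcfType) (r : R) : `|r%:C| = `|r|%:C.
Proof. by rewrite normc_def /= expr0n /= addr0 sqrtr_sqr. Qed.

Lemma le_normC_Re_Im (R : rcfType) (a b : R) : `|a +i* b| <= (`|a| + `|b|)%:C.
Proof.
have -> : a +i* b = a%:C + 'i * b%:C by simpc.
rewrite (le_trans (ler_normD _ _))// normrM !normr_real_complex.
by rewrite normc_def /= expr0n expr1n add0r sqrtr1 mul1r rmorphD.
Qed.

Lemma cvg_complex {R : realType} {T : Type} (F : set_system T) {FF : Filter F}
  (f g : T -> R) (a b : R) :
  f @ F --> a -> g @ F --> b -> (fun t => f t +i* g t) @ F --> (a +i* b : R[i]).
Proof.
(* The radius ranges over the positive elements of [R[i]]; these are real, since the order compares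
   only numbers with equal imaginary part. *)
move=> fa gb; apply/(@cvgrPdist_lt _ R[i]^o) => _ /gtC0_real[e e0 ->].
have e20 : 0 < e / 2 by lra.
have fa2 := cvgr_dist_lt _ _ fa _ e20; have gb2 := cvgr_dist_lt _ _ gb _ e20.
near=> t.
have -> : (a +i* b) - (f t +i* g t) = (a - f t) +i* (b - g t) by [].
rewrite (le_lt_trans (le_normC_Re_Im _ _ _))// ltcR (splitr e).
by rewrite ltrD//; near: t; [exact: fa2|exact: gb2].
Unshelve. all: by end_near. Qed.

(** Cauchy's functional equation on an interval, with boundedness in place of continuity:
    subtracting the chord through [(d, h d)] leaves an additive bounded [g] with [g d = 0], and
    repeated halving of its bound forces [g = 0]. *)
Lemma additive_bounded_linear (R : realType) (h : R -> R) (d M : R) :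
  0 < d ->
  (forall s t, 0 <= s -> 0 <= t -> s + t <= d -> h (s + t) = h s + h t) ->
  (forall t, 0 <= t <= d -> `|h t| <= M) ->
  forall t, 0 <= t <= d -> h t = h d / d * t.
Proof.
move=> d0 hD hM.
pose g t := h t - h d / d * t.
have gD s t : 0 <= s -> 0 <= t -> s + t <= d -> g (s + t) = g s + g t.
  by move=> *; rewrite /g hD//; ring.
have gd : g d = 0 by rewrite /g divfK ?subrr// gt_eqF.
(* A bound for [g] on [0, d] can be halved: use [g (2t) = 2 g t] on the left
   half and [g t = - g (d - t)] on the right half. *)
have g_half n t : 0 <= t <= d -> `|g t| <= (M + `|h d|) / 2 ^+ n.
  elim: n t => [|n IHn].
    move=> t /andP[t0 td]; rewrite expr0 divr1 (le_trans (ler_normB _ _))//.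
    rewrite lerD// ?hM ?t0// -mulrA normrM ler_piMr//.
    rewrite (mulrC d^-1) ger0_norm ?divr_ge0 ?(ltW d0)//.
    by rewrite ler_pdivrMr ?mul1r.
  have left_half t : 0 <= t -> t + t <= d -> `|g t| <= (M + `|h d|) / 2 ^+ n.+1.
    move=> t0 ttd; have := IHn (t + t); rewrite ttd addr_ge0// => /(_ isT).
    rewrite gD// -[g t + _]mulr2n normrMn exprS invfM mulrCA -mulr_natl.
    by set B := _ / _; lra.
  move=> t /andP[t0 td]; case: (lerP (t + t) d) => [|ttd]; first exact: left_half.
  have -> : g t = - g (d - t).
    by have := gD t (d - t); rewrite subrKC gd; lra.
  by rewrite normrN left_half//; lra.
move=> t td; apply/eqP; rewrite -subr_eq0 -/(g t) -normr_le0.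
have : (fun n => (M + `|h d|) / 2 ^+ n) @ \oo --> (0 : R).
  under eq_fun do rewrite -exprVn.
  by apply: cvg_geometric; rewrite ger0_norm; lra.
move=> lim0; have lim := cvg_lim (@Rhausdorff R) lim0; rewrite -lim.
by apply: limr_ge; [exact: (cvgP _ lim0)|apply: nearW => n; exact: g_half].
Qed.


(** * Angles of unimodular numbers and semigroups in the unit circle *)

Lemma Re_Im_sqr1 {R : rcfType} {z : R[i]} :
  `|z| = 1 -> complex.Re z ^+ 2 + complex.Im z ^+ 2 = 1.
Proof.
move=> z1; have := add_Re2_Im2 z; rewrite z1 expr1n => -[->].
by [].
Qed.

(** Beyond [pi / 2] the cosine is [- sin (|a| - pi / 2)], which is nonpositive up to [pi]. *)
Lemma cos_gt0_abs_pihalf (R : realType) (a : R) :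
  `|a| <= pi -> 0 < cos a -> `|a| <= pi / 2.
Proof.
have -> : cos a = cos `|a| by case: (ger0P a) => // _; rewrite cosN.
move=> api; rewrite real_leNgt ?num_real// => + ; apply: contraTN => a2.
have := cosDpihalf (`|a| - pi / 2); rewrite subrK => ->.
rewrite -leNgt oppr_le0 sin_ge0_pi//; have := pi_ge0 R; lra.
Qed.

(** On the right half of the circle the sine determines the angle, and the nonnegative real part
    fixes the sign of the root in [cos (asin y) = sqrt (1 - y^2)]. *)
Lemma angle_of_unimodular (R : realType) (z : R[i]) (th := asin (complex.Im z)) :
  `|z| = 1 -> 0 <= complex.Re z ->
  [/\ cos th = complex.Re z, sin th = complex.Im z & `|th| <= pi / 2].
Proof.
move=> z1 Rz0; have z2 := Re_Im_sqr1 z1.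
have Iz : -1 <= complex.Im z <= 1.
  by rewrite -ler_norml -ler_sqr ?nnegrE// expr1n real_normK ?num_real//; nra.
rewrite /th; split.
- by rewrite cos_asin// -z2 addrK sqrtr_sqr ger0_norm.
- by rewrite asinK// in_itv.
- by rewrite ler_norml asin_geNpi2// asin_lepi2.
Qed.

Lemma is_derive_right_quotient {R : realType} (g : R -> R) (dg : R) :
  is_derive (0 : R) (1 : R) g dg -> (fun t => t^-1 * (g t - g 0)) @ 0^'+ --> dg.
Proof.
move=> [dg1 <-]; apply: cvg_dnbhs_at_right; apply: cvg_trans dg1.
apply: near_eq_cvg; apply: nearW => t /=.
by rewrite addr0 /GRing.scale /= mulr1.
Qed.

Lemma unimodular_semigroup_derivative (R : realType) (f : R -> R[i]) :
  (forall t, 0 <= t -> `|f t| = 1) ->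
  (forall s t, 0 <= s -> 0 <= t -> f (s + t) = f s * f t) ->
  f t @[t --> 0^'+] --> (1 : R[i]) ->
  exists lam : R,
    (fun t => (t^-1)%:C * (f t - 1)) @ 0^'+ --> ('i * lam%:C : R[i]).
Proof.
move=> f1 fD fcvg.
have f0 : f 0 = 1.
  have := fD 0 0; rewrite addr0 => /(_ (lexx _) (lexx _)) f00.
  have fn0 : f 0 != 0 by rewrite -normr_eq0 f1// oner_eq0.
  by apply: (mulfI fn0); rewrite -f00 mulr1.
(* A number at distance less than 1 from 1 has positive real part. With [d = e / 4], the point
   [d + d = e / 2] stays inside the neighbourhood of radius [e]. *)
have [d d0 Rf] : exists2 d, 0 < d & forall t, 0 <= t <= d + d -> 0 < complex.Re (f t).
  have h : 0 < (1 : R)%:C by rewrite ltcR.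
  have [e /= e0 fe] := @cvgr_dist_lt _ R[i]^o _ _ _ _ _ fcvg _ h.
  exists (e / 4) => [|t]; first lra.
  rewrite le_eqVlt => /andP[/predU1P[<- _|t0 te]]; first by rewrite f0.
  have /(fe t)/(_ t0)/(le_lt_trans (normc_ge_Re _)) : ball_ Num.norm 0 e t.
    by rewrite /ball_ /= sub0r normrN gtr0_norm//; lra.
  by rewrite ltcR raddfB/= ltr_norml; lra.
pose th t := asin (complex.Im (f t)).
have thP t : 0 <= t <= d + d -> [/\ cos (th t) = complex.Re (f t),
    sin (th t) = complex.Im (f t) & `|th t| <= pi / 2].
  move=> td; apply: angle_of_unimodular; first by rewrite f1//; case/andP: td.
  by rewrite ltW// Rf.
have thd t : 0 <= t <= d -> `|th t| <= pi / 2.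
  by move=> td; have [] // := thP t; lra.
have thD s t : 0 <= s -> 0 <= t -> s + t <= d -> th (s + t) = th s + th t.
  move=> s0 t0 std.
  have [cs ss bs] := thP s ltac:(lra).
  have [ct st bt] := thP t ltac:(lra).
  have [cst sst bst] := thP (s + t) ltac:(lra).
  have std2 : 0 <= s + t <= d + d by lra.
  have sinst : sin (th (s + t)) = sin (th s + th t).
    by rewrite sst fD// sinD cs ss ct st; case: (f s) (f t) => [? ?] [? ?] /=; ring.
  (* A priori [th s + th t] lies only in [[-pi, pi]], where equal sines do not give equal angles.
     Its cosine is the real part of [f (s + t)], hence positive, which confines it to
     [[-pi/2, pi/2]], where [sin] is injective. *)
  have cosst : 0 < cos (th s + th t).
    have := Rf _ std2.
    by rewrite fD// cosD cs ss ct st; case: (f s) (f t) => [? ?] [? ?].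
  apply: sin_inj sinst; rewrite in_itv/= -ler_norml//.
  rewrite cos_gt0_abs_pihalf// (le_trans (ler_normD _ _))//; lra.
have thE := additive_bounded_linear _ _ _ _ d0 thD thd.
set lam := th d / d in thE; exists lam.
have fE t : 0 <= t <= d -> f t = cos (lam * t) +i* sin (lam * t).
  move=> td; have [c s _] := thP t ltac:(lra).
  by rewrite -thE// c s; case: (f t).
have -> : 'i * lam%:C = 0 +i* lam by simpc.
have dlam : is_derive (0 : R) (1 : R) (fun t => lam * t) lam.
  have := is_deriveZ lam (is_derive_id (0 : R^o) (1 : R^o)).
  by rewrite [lam *: 1]mulr1.
(* The real and imaginary parts of the quotient are right difference quotients at 0 of
   [cos (lam * t)] and [sin (lam * t)]. *)
have ccvg : (fun t => t^-1 * (cos (lam * t) - 1)) @ 0^'+ --> (0 : R).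
  have := is_derive_right_quotient _ _ (is_derive1_comp (is_derive_cos (lam * 0)) dlam).
  by rewrite /= mulr0 sin0 cos0 oppr0 mul0r.
have scvg : (fun t => t^-1 * sin (lam * t)) @ 0^'+ --> lam.
  have := is_derive_right_quotient _ _ (is_derive1_comp (is_derive_sin (lam * 0)) dlam).
  by rewrite /= mulr0 sin0 cos0 mul1r; under eq_fun do rewrite subr0.
apply: cvg_trans (cvg_complex (0 : R)^'+ _ _ _ _ ccvg scvg).
apply: near_eq_cvg; near=> t.
rewrite fE.
  by apply/eqP; rewrite eq_complex /=; apply/andP; split; apply/eqP; ring.
apply/andP; split; first by near: t; exact: nbhs_right_ge.
by near: t; exact: nbhs_right_le.
Unshelve. all: by end_near. Qed.

(** * Strong exposedness and the orbit of [x] *)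

Lemma dual_norm_oneP {R : realType} {X : completeNormedModType R[i]}
  (f : {scalar X}) : dual_norm_one f -> forall y, `|f y| <= `|y|.
Proof.
move=> [f1 _] y; have [->|y0] := eqVneq y 0; first by rewrite linear0 !normr0.
have ny0 : 0 < `|y| by rewrite normr_gt0.
have := f1 (`|y|^-1 *: y); rewrite normrZ normfV normr_id mulVf ?gt_eqF// lexx.
by move=> /(_ isT); rewrite scalarZ normrM normfV normr_id ler_pdivrMl// mulr1.
Qed.

(** Since [f x = 1], the point [x] lies in every slice, so a small diameter bounds the distance to
    [x]. *)
Lemma strongly_exposes_near {R : realType} {X : completeNormedModType R[i]}
  (f : {scalar X}) (x : X) (e : R) :
  `|x| = 1 -> strongly_exposes f x -> 0 < e ->
  exists2 d : R, 0 < d &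
    forall y, `|y| <= 1 -> 1 - d <= complex.Re (f y) -> `|y - x| <= e%:C.
Proof.
move=> x1 [_ [fx1 diam]] /diam[d [d0 dP]].
exists (d / 2) => [|y y1 fy]; first lra.
apply: (dP (d / 2)); [lra|lra|by split|split]; first by rewrite x1.
by rewrite fx1 /=; lra.
Qed.

Lemma unimodular_rotation {R : rcfType} (z : R[i]) :
  z != 0 -> exists2 c : R[i], `|c| = 1 & c * z = `|z|.
Proof.
move=> z0; exists (`|z| / z); last by rewrite divfK.
by rewrite normrM normr_id normfV divff// normr_eq0.
Qed.

Section Semigroup.
Context {R : realType} {X : completeNormedModType R[i]} (x : X) (xs : {scalar X})
  (T : R -> {linear X -> X}).
Hypotheses (x1 : `|x| = 1) (xs_exposes : strongly_exposes xs x)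
  (TC0 : C0_contraction_semigroup T)
  (weak_lim : `|xs (T t x)| @[t --> +oo] --> (1 : R[i])).

Lemma rotated_orbit_cvg (e : R) : 0 < e ->
  exists M : R, forall t, M < t -> 0 <= t ->
    exists2 c : R[i], `|c| = 1 & `|c *: T t x - x| <= e%:C.
Proof.
move=> /(strongly_exposes_near _ _ _ x1 xs_exposes)[d d0 dP].
(* The bound [d] puts the rotated vector in the slice; [1 / 2] keeps [xs (T t x)] away from 0, so
   that it can be rotated. *)
have h : 0 < (Num.min d (1 / 2))%:C by rewrite ltcR lt_min d0; lra.
have [M [_ MP]] := @cvgr_dist_lt _ R[i]^o _ _ _ _ _ weak_lim _ h.
exists M => t /MP fd t0.
have [r r0 fr] := geC0_real _ _ (normr_ge0 (xs (T t x))).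
move: fd; rewrite fr -(rmorphB (real_complex R) 1) normr_real_complex ltcR lt_min.
move=> /andP[rd r2].
have f0 : xs (T t x) != 0.
  rewrite -normr_eq0 fr; apply/eqP => -[rE]; move: r2.
  by rewrite rE subr0 normr1; lra.
have [c c1 cE] := unimodular_rotation _ f0.
exists c => //; apply: dP; first by rewrite normrZ c1 mul1r -x1; case: TC0 => _ [_ [_ ->]].
by rewrite scalarZ cE fr /=; move: rd; rewrite ltr_norml; lra.
Qed.

Lemma orbit_near_circle (s e : R) : 0 <= s -> 0 < e ->
  exists2 u : R[i], `|u| = 1 & `|T s x - u *: x| <= e%:C.
Proof.
move=> s0 e0; have e20 : 0 < e / 2 by lra.
case: TC0 => _ [TD [_ Tle]].
have [M MP] := rotated_orbit_cvg _ e20.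
have [t Mt t0] : exists2 t, M < t & 0 <= t.
  by exists (`|M| + 1); have := ler_norm M; have := normr_ge0 M; lra.
have [c c1 cP] := MP t Mt t0.
have [c' c'1 c'P] := MP (s + t) ltac:(lra) ltac:(lra).
have c'0 : c' != 0 by rewrite -normr_eq0 c'1 oner_eq0.
have u1 : `|c / c'| = 1 by rewrite normrM normfV c1 c'1 divr1.
exists (c / c') => //.
(* Both terms have norm at most [e / 2]: the first because [c / c'] is unimodular, the second
   because [T s] is a contraction. *)
have -> : T s x - (c / c') *: x =
    (c / c') *: (c' *: T (s + t) x - x) - T s (c *: T t x - x).
  have -> : T s (c *: T t x - x) = c *: T (s + t) x - T s x.
    by rewrite linearB linearZ /= TD.
  rewrite scalerBr scalerA divfK//.
  by rewrite opprB [RHS]addrC addrA subrK.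
rewrite (le_trans (ler_normB _ _))// (splitr e) rmorphD lerD//.
  by rewrite normrZ u1 mul1r.
exact: le_trans (Tle _ s0 _) cP.
Qed.

(** The unimodular [u] approximating [T s x] by [u *: x] varies with [e], but applying [xs] shows
    that it is within [e] of the fixed number [xs (T s x)], which can therefore replace it. *)
Lemma orbit_eigenvector (s : R) : 0 <= s ->
  `|xs (T s x)| = 1 /\ T s x = xs (T s x) *: x.
Proof.
move=> s0; have [dual1 [xsx _]] := xs_exposes.
have close e : 0 < e -> exists u, [/\ `|u| = 1, `|T s x - u *: x| <= e%:C &
    `|xs (T s x) - u| <= e%:C].
  move=> /(orbit_near_circle _ _ s0)[u u1 ue]; exists u; split => //.
  have := dual_norm_oneP _ dual1 (T s x - u *: x).
  by rewrite raddfB /= scalarZ xsx mulr1 => /le_trans; apply.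
have eq0 (z : R[i]) : 0 <= z -> (forall e : R, 0 < e -> z <= (e + e)%:C) -> z = 0.
  move=> /geC0_real[r r0 ->] re; congr (_%:C); apply/eqP.
  rewrite eq_le r0 andbT; apply/ler_addgt0Pr => e e0.
  by rewrite add0r (splitr e) -lecR re//; lra.
split; apply/eqP; rewrite -subr_eq0 -normr_eq0; apply/eqP/eq0 => // e e0;
  have [u [u1 Tu fu]] := close e e0.
  rewrite -[X in _ - X]u1 (le_trans (ler_dist_dist _ _))// (le_trans fu)// lecR.
  lra.
have -> : T s x - xs (T s x) *: x = (T s x - u *: x) - (xs (T s x) - u) *: x.
  by rewrite scalerBl opprB addrA subrK.
by rewrite (le_trans (ler_normB _ _))// rmorphD lerD// normrZ x1 mulr1.
Qed.

End Semigroup.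

Theorem theorem4 (R : realType) (X : completeNormedModType R[i])
  (x : X) (xs : {scalar X}) (T : R -> {linear X -> X}) :
  `|x| = 1 ->
  continuous xs ->
  strongly_exposes xs x ->
  C0_contraction_semigroup T ->
  `|xs (T t x)| @[t --> +oo] --> (1 : R[i]) ->
  exists lam : R, generator_at T x (('i * lam%:C) *: x).
Proof.
move=> x1 xsC xs_exposes TC0 weak_lim.
have eigen := orbit_eigenvector _ _ _ x1 xs_exposes TC0 weak_lim.
have [T0 [TD [Tcvg _]]] := TC0; have [_ [xsx _]] := xs_exposes.
have [||| lam lamP] := unimodular_semigroup_derivative _ (fun t => xs (T t x)).
- by move=> t /eigen[].
- move=> s t s0 t0; rewrite TD//.
  by rewrite (eigen t t0).2 linearZ /= !scalarZ xsx mulr1 mulrC.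
- rewrite -xsx; apply: (continuous_cvg _ (xsC x)); exact: Tcvg.
(* As [T t x] is [xs (T t x) *: x], the generator quotient is the scalar quotient times [x]. *)
exists lam; apply: cvg_trans (cvgZr_tmp (a := x) lamP).
apply: near_eq_cvg; near=> t.
have t0 : 0 <= t by near: t; exact: nbhs_right_ge.
have -> : T t x - x = (xs (T t x) - 1) *: x.
  by rewrite scalerBl scale1r -(eigen t t0).2.
by rewrite scalerA.
Unshelve. all: by end_near. Qed.
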